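(* Assume that $\mathrm{MA(countable)}$ holds. Then there exists an ultrafilter $\mathcal{U}\subseteq 2^\omega$ on $\omega$ that is not countable dense homogeneous.
   Context: Every subset of $\omega$ is identified with its characteristic function, so an ultrafilter on $\omega$ is regarded as a subset of the Cantor set $2^\omega$ and carries the subspace topology. A (separable metrizable) space $X$ is countable dense homogeneous if for every pair $(D,E)$ of countable dense subsets of $X$ there exists a homeomorphism $f:X\to X$ such that $f[D]=E$. $\mathrm{MA(countable)}$ (Martin's Axiom for countable posets) is the statement: for every non-empty countable partially ordered set $\mathbb{P}$ and every collection $\mathcal{D}$ of dense subsets of $\mathbb{P}$ with $|\mathcal{D}|<\mathfrak{c}=2^{\aleph_0}$, there is a filter $G\subseteq\mathbb{P}$ that meets every element of $\mathcal{D}$. *)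

(* Defs.v *)
From HB Require Import structures.
From mathcomp Require Import all_boot all_order.
From mathcomp Require Import all_classical topology cantor.

Set Implicit Arguments.
Unset Strict Implicit.
Unset Printing Implicit Defensive.

Local Open Scope classical_set_scope.
Local Open Scope card_scope.

Definition card_lt (T U : Type) (A : set T) (B : set U) : Prop :=
  A #<= B /\ ~ (B #<= A).

(* Forcing convention: dense means downward dense, and filters are upward
   closed and downward directed. *)
Definition poset_dense (d : Order.disp_t) (P : porderType d) (D : set P) :
    Prop :=
  forall p, exists2 q, D q & (q <= p)%O.

Definition poset_filter (d : Order.disp_t) (P : porderType d) (G : set P) :
    Prop :=
  [/\ G !=set0,
      forall p q, G p -> (p <= q)%O -> G q &
      forall p q, G p -> G q -> exists r, [/\ G r, (r <= p)%O & (r <= q)%O]].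

(* The continuum is represented by the set of all functions nat -> bool. *)
Definition MA_countable : Prop :=
  forall (d : Order.disp_t) (P : porderType d) (DD : set (set P)),
    [set: P] !=set0 -> countable [set: P] ->
    DD `<=` @poset_dense d P -> card_lt DD [set: nat -> bool] ->
    exists2 G : set P, poset_filter G & forall D, DD D -> G `&` D !=set0.

Definition homeomorphism (X Y : topologicalType) (f : X -> Y) : Prop :=
  continuous f /\
  exists g : Y -> X, [/\ continuous g, cancel f g & cancel g f].

(* In the library, countable includes finite. *)
Definition countable_dense_homogeneous (X : topologicalType) : Prop :=
  forall D E : set X,
    countable D -> dense D -> countable E -> dense E ->
    exists2 f : X -> X, homeomorphism f & f @` D = E.

(* A family of subsets of nat, identified with the set of the characteristic
   functions of its members.  Its coercion to a type, set_type, carries the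
   subspace topology. *)
Definition cantor_set_of (F : set_system nat) : set cantor_space :=
  [set chi : cantor_space | F [set n | chi n]].

(* Main.v *)
From HB Require Import structures.
Require Import Defs.
From mathcomp Require Import all_boot all_order.
From mathcomp Require Import all_classical topology cantor.

(** Points of the Cantor space are identified with subsets of omega.  Fix an
    independent family of sets d_0, d_1, ... that is dense in the Cantor space,
    and let Cof be the countable dense set of cofinite sets.  The ultrafilter U
    will contain Cof and every d_i, and no homeomorphism of U will map Cof onto
    {d_0, d_1, ...}.

    A homeomorphism f of U with f[Cof] = {d_i} is determined by its restriction
    to Cof, hence by a function h from codes of cofinite sets to indices; there
    are only continuum many of these (decode_surj).  To exclude h it suffices to
    put into U a set u at which the continuous map coded by h has a limit v,
    together with the complement of v: then f u would be v, which is not in U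
    (not_countable_dense_homogeneous).

    All these sets u \ v are chosen by a transfinite recursion of length
    continuum, in which each stage has fewer than continuum many predecessors.
    The induction hypothesis (meets_large) is that every finite intersection w
    of earlier choices is large: for each j there is N such that w meets, in an
    infinite set, every intersection of d_0, ..., d_(j-1) with finitely many
    complements of sets d_i, i >= N.  So w may be almost contained in finitely
    many of the d_i only.  This is what makes the next step possible
    (large_generic_difference): Martin's Axiom gives a point u that is Cohen
    generic over the earlier choices, and we claim that w meets u \ v as
    required.  A finite condition p fixing part of u has infinitely many
    cofinite extensions x, and h sends them to infinitely many indices; choose x
    with h x >= N.  As w is not almost contained in d_(h x) while x is cofinite,
    there are arbitrarily large n in w and x that lie outside d_(h x), and by
    continuity at x a longer piece of x already forces n to be in u \ v.

    The recursion has to run over an index set whose initial segments have fewer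
    than continuum many finite subsets, because each stage has to treat every
    finite intersection of earlier choices.  Such an index set is built directly
    (continuum_enumeration), without arithmetic of infinite cardinals: take the
    shortest initial segment A of a well-ordering of the reals over which there
    are continuum many finite words, and use these words themselves as indices,
    ordered first by the least upper bound of their letters. *)

Set Implicit Arguments.
Unset Strict Implicit.
Unset Printing Implicit Defensive.

Local Open Scope classical_set_scope.
Local Open Scope card_scope.

Local Notation real := (nat -> bool).

(** * Well-orderings and sets of size continuum *)

Lemma continuum_leP (I : Type) (S : set I) :
  [set: real] #<= S <-> exists2 phi : real -> I, injective phi & forall x, S (phi x).
Proof.
split=> [/card_leP/unsquash f | [phi inj_phi phiS]].
  exists (fun x => val (f (to_setT x))) => [x y /val_inj/inj e|x].
    by have := e (in_setT _) (in_setT _); case.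
  exact: set_valP.
rewrite -(card_le_eql (inj_card_eq (fun x y _ _ => @inj_phi x y))).
by apply: subset_card_le => _ [x _ <-].
Qed.

Lemma well_founded_min (X : Type) (lt : X -> X -> Prop) :
  (forall A : set X, A !=set0 -> exists2 m, A m & forall a, lt a m -> ~ A a) ->
  well_founded lt.
Proof.
move=> min; apply: contrapT => /existsNP nwf.
have [m nm ltm] := min [set x | ~ Acc lt x] nwf.
by apply: nm; constructor => a /ltm/contrapT.
Qed.

Lemma well_orderable (T : eqType) : exists R : rel T,
  [/\ transitive R, antisymmetric R, total R &
      forall A : set T, A !=set0 -> exists2 m, A m & forall a, A a -> R m a].
Proof.
have [R woR] := wochoice.well_ordering_principle T; exists R.
have minR (A : set T) : A !=set0 -> exists2 m, A m & forall a, A a -> R m a.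
  move=> [x Ax]; have [] := woR [pred x | `[< A x >]].
    by exists x; apply/asboolP.
  move=> m [[/asboolP Am lbm] _]; exists m => // a Aa.
  by apply: lbm; apply/asboolP.
have wo1 : wochoice.wo_chain R T by move=> A _; exact: woR.
have tot : total R by move=> x y; exact: (wochoice.wo_chainW wo1).
have anti : antisymmetric R by move=> x y; exact: (wochoice.wo_chain_antisymmetric wo1).
split=> // y x z Rxy Ryz.
have [|m] := minR [set u | [|| u == x, u == y | u == z]].
  by exists x; rewrite /= eqxx.
move=> /= /or3P[] /eqP-> lb; first by apply: lb; rewrite eqxx !orbT.
- by have -> : x = y by [apply: anti; rewrite Rxy lb // eqxx].
- have <- : y = z by apply: anti; rewrite Ryz lb // eqxx orbT.
  exact: Rxy.
Qed.

(** * An enumeration of the reals with small initial segments *)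

Section Enumeration.

(* The letters from nat serve as delimiters and as spare symbols: with them,
   finite sequences of words are again words over the same set of reals. *)
Local Notation word := (seq (real + nat)).

Definition over (A : set real) (l : word) := forall a, inl a \in l -> A a.

(** Concatenates words injectively: each one is preceded by its length. *)
Definition flat (l : seq (word + nat)) : word :=
  flatten [seq match x with
           | inl u => [:: inr 0, inr (size u) & u]
           | inr n => [:: inr 1; inr n] end | x <- l].

Lemma flat_inj : injective flat.
Proof.
elim=> [|x l IH] [|x' l']; rewrite /flat /= -/(flat _) //; first by case: x'.
- by case: x.
case: x x' => [u|n] [u'|n'] //= [].
  move=> ss /eqP; rewrite eqseq_cat // => /andP[/eqP-> /eqP e].
  by congr (_ :: _); apply: IH.
by move=> -> e; congr (_ :: _); apply: IH.
Qed.

Lemma over_flat A (l : seq (word + nat)) :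
  (forall u, inl u \in l -> over A u) -> over A (flat l).
Proof.
elim: l => [|x l IH] lA a; first by [].
rewrite /flat /= mem_cat -/(flat _) => /orP[|al]; last first.
  by apply: IH al => u ul; apply: lA; rewrite inE ul orbT.
by case: x lA => [u|n] lA; rewrite !inE //=; apply: lA; rewrite inE eqxx.
Qed.

(** Removes the letter m from the alphabet by giving it a spare symbol. *)
Definition hide (m : real) (x : real + nat) : real + nat :=
  match x with inl a => if a == m then inr 0 else inl a | inr n => inr n.+1 end.

Lemma hide_inj m : injective (hide m).
Proof.
move=> [a|n] [a'|n'] /=.
- by case: eqP => [->|_]; case: eqP => [->|_] // [->].
- by case: eqP.
- by case: eqP.
- by case=> ->.
Qed.

(** Bigness is measured by words over A, not by A itself, since the recursion has
    to count finite subsets. *)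
Definition big (A : set real) := [set: real] #<= [set l | over A l].

Lemma big_setT : big setT.
Proof.
by apply/continuum_leP; exists (fun x => [:: inl x]) => // x y [].
Qed.

(** Words without letters from the reals are words over nat, so this is Cantor's
    theorem that the reals are uncountable. *)
Lemma big_nonempty A : big A -> A !=set0.
Proof.
move=> /continuum_leP[phi inj_phi phiA]; apply: contrapT => A0.
pose g x := pickle [seq if y is inr n then n else 0 | y <- phi x].
have inj_g : injective g.
  move=> x y /(pcan_inj pickleK) e; apply: inj_phi.
  have noinl u : forall a, inl a \notin phi u.
    by move=> a; apply/negP => /phiA Aa; apply: A0; exists a.
  elim: (phi x) (phi y) (noinl x) (noinl y) e => [|u l IH] [|u' l'] // nl nl'.
  case: u u' nl nl' => [a|n] [a'|n'] nl nl' /=.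
  - by have := nl a; rewrite inE eqxx.
  - by have := nl a; rewrite inE eqxx.
  - by have := nl' a'; rewrite inE eqxx.
  move=> [-> e]; congr (_ :: _); exact: IH.
(* Cantor's diagonal set *)
pose x n := `[< exists2 y, g y = n & ~~ y n >].
have [xx|xx] := boolP (x (g x)).
  by have /asboolP[y /inj_g ->] := xx; rewrite xx.
by have /negP := xx; apply; apply/asboolP; exists x.
Qed.

Lemma big_del A m : big A -> big (A `\ m).
Proof.
move=> /continuum_leP[phi inj_phi phiA].
apply/continuum_leP; exists (fun x => map (hide m) (phi x)) => [x y|x].
  by move=> /(inj_map (@hide_inj m))/inj_phi.
move=> a /mapP[[b|//] bx] /=; case: eqP => // bm [->]; split; first exact: phiA bx.
exact: bm.
Qed.

(** A is the shortest big initial segment of a well-ordering R.  It has no last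
    element m, since by big_del it would stay big without m; this is why even the
    segments that include their endpoint are not big. *)
Lemma big_minimal : exists (R : rel real) (A : set real),
  [/\ [/\ transitive R, antisymmetric R, total R &
      forall B : set real, B !=set0 -> exists2 m, B m & forall a, B a -> R m a],
      big A,
      forall a m, A m -> R a m -> A a &
      forall m, A m -> ~ big [set a | R a m]].
Proof.
have [R [trR antiR totR minR]] := well_orderable real.
pose below m := [set a | R a m] `\ m.
suff [A [bigA downA smallA]] : exists A, [/\ big A, forall a m, A m -> R a m -> A a
   & forall m, A m -> ~ big (below m)].
  exists R, A; split=> // m Am /(big_del m); exact: smallA.
have [[m bm]|nb] := pselect (exists m, big (below m)).
  have [m0 bm0 minm0] := minR [set m | big (below m)] (ex_intro _ m bm).
  exists (below m0); split=> // [a b [Rb bm0'] Rab|b [Rb bm0'] bb].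
    split; first exact: trR Rab Rb.
    by move=> /= e; apply: bm0'; apply: antiR; rewrite Rb -e.
  by apply: bm0'; apply: antiR; rewrite Rb minm0.
exists setT; split=> //; first exact: big_setT.
by move=> m _ bm; apply: nb; exists m.
Qed.

(** The index set X of the recursion consists of the words over A.  The letters
    of all words below x are bounded by the bound of x, so finite sequences of
    such words are, up to coding, words over a proper initial segment of A, and
    there are fewer than continuum many of them. *)
Lemma continuum_enumeration :
  exists (X : eqType) (lt : X -> X -> Prop) (e : X -> real),
  [/\ well_founded lt,
      forall x y z, lt x y -> lt y z -> lt x z,
      forall x y, [\/ lt x y, x = y | lt y x],
      forall r, exists x, e x = r &
      forall x, ~ ([set: real] #<=
        [set l : seq X | forall y, y \in l -> lt y x] `*` [set: nat])].
Proof.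
have [R [A [[trR antiR totR minR] bigA downA smallA]]] := big_minimal.
have [Q [trQ antiQ totQ minQ]] := well_orderable word.
pose bnd m l := over [set a | R a m] l.
have bndP l : over A l -> exists2 m, A m & bnd m l.
  elim: l => [|x l IH] Axl; first by have [m Am] := big_nonempty bigA; exists m.
  have [|m Am ml] := IH; first by move=> a al; apply: Axl; rewrite inE al orbT.
  case: x Axl => [b|n] Axl; last by exists m => // a; rewrite inE /=; exact: ml.
  have Ab : A b by apply: Axl; rewrite inE eqxx.
  case/orP: (totR b m) => [Rbm|Rmb].
    by exists m => // a; rewrite inE => /orP[/eqP[->]//|]; exact: ml.
  exists b => // a; rewrite inE => /orP[/eqP[->]//|/ml Ram]; last exact: trR Ram Rmb.
  by have := totR b b; rewrite orbb.
have /choice[mx mxP] : forall l, exists m,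
    over A l -> [/\ A m, bnd m l & forall m', bnd m' l -> R m m'].
  move=> l; have [Al|] := pselect (over A l); last by exists (fun=> true).
  have [m Am ml] := bndP _ Al.
  have [m0 m0l m0min] := minR [set m | bnd m l] (ex_intro _ m ml).
  by exists m0 => _; split=> //; apply: downA Am _; exact: m0min.
pose X := {l : word | `[< over A l >]}.
have overX (x : X) : over A (val x) by case: x => l /= /asboolP.
pose slt (T : eqType) (r : rel T) a b := r a b /\ a <> b.
have slt_tr (T : eqType) (r : rel T) a b c : transitive r -> antisymmetric r ->
    slt T r a b -> slt T r b c -> slt T r a c.
  move=> trr antir [rab nab] [rbc nbc]; split; first exact: trr rab rbc.
  by move=> ac; apply: nab; apply: antir; rewrite rab ac rbc.
pose lt (x y : X) := slt _ R (mx (val x)) (mx (val y)) \/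
   mx (val x) = mx (val y) /\ slt _ Q (val x) (val y).
have [phi inj_phi phiA] := (continuum_leP _).1 bigA.
have phiX r : `[< over A (phi r) >] by apply/asboolP/phiA.
pose e (x : X) := get [set r | phi r = val x].
exists X, lt, e; split.
- (* first minimize the bound, then the word among those with that bound *)
  apply: well_founded_min => B [x0 Bx0].
  have [_ [x1 Bx1 <-] min1] := minR [set mx (val x) | x in B]
    (ex_intro _ _ (ex_intro2 _ _ _ Bx0 erefl)).
  have [_ [x2 [Bx2 e2] <-] min2] :=
    minQ [set val x | x in B `&` [set x | mx (val x) = mx (val x1)]]
      (ex_intro _ _ (ex_intro2 _ _ _ (conj Bx1 erefl) erefl)).
  exists x2 => // x [[Rxx nxx]|[exx [Qxx nxx]]] Bx; apply: nxx.
    by apply: antiR; rewrite Rxx e2 min1 //; exists x.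
  by apply: antiQ; rewrite Qxx min2 //; exists x => //; split=> //=; rewrite exx.
- move=> x y z [xy|[exy xy]] [yz|[eyz yz]].
  + by left; apply: slt_tr yz.
  + by left; rewrite -eyz.
  + by left; rewrite exy.
  + by right; rewrite exy eyz; split=> //; apply: slt_tr yz.
- move=> x y.
  have [exy|nxy] := eqVneq (mx (val x)) (mx (val y)).
    have [|nv] := eqVneq (val x) (val y); first by move=> /val_inj ->; constructor 2.
    case/orP: (totQ (val x) (val y)) => q; [constructor 1|constructor 3];
      right; split=> //.
      by split=> //; exact/eqP.
    by split=> // ee; move: nv; rewrite ee eqxx.
  case/orP: (totR (mx (val x)) (mx (val y))) => q; [constructor 1|constructor 3];
    left; split=> //.
    exact/eqP.
  by move=> ee; move: nxy; rewrite ee eqxx.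
- move=> r; exists (exist _ (phi r) (phiX r)).
  by apply: inj_phi; exact: (getPex (ex_intro [set r' | phi r' = phi r] r erefl)).
- move=> x /continuum_leP[psi inj_psi psiP].
  have [Am _ _] := mxP _ (overX x); apply: (smallA _ Am).
  apply/continuum_leP.
  exists (fun r => flat (inr (psi r).2 :: [seq inl (val y) | y <- (psi r).1])).
    move=> r r' /flat_inj[e2 /inj_map e1]; apply: inj_psi.
    have {}e1 : (psi r).1 = (psi r').1 by apply: e1 => y y' [/val_inj].
    by rewrite (surjective_pairing (psi r)) e1 e2 -surjective_pairing.
  move=> r; apply: over_flat => u; rewrite inE /= => /mapP[y yr [->]] a ay.
  have [_ bndy _] := mxP _ (overX y).
  have [/(_ y yr) ltyx _] := psiP r.
  apply: trR (bndy _ ay) _.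
  by case: ltyx => [[]//|[-> _]]; have := totR (mx (val x)) (mx (val x)); rewrite orbb.
Qed.

End Enumeration.

(** * Cohen forcing under Martin's Axiom *)

(** An alias of seq bool, so that it can carry the order of Cohen forcing. *)
Definition cond : Type := seq bool.
HB.instance Definition _ := Countable.on cond.

Fact cond_display : Order.disp_t. Proof. exact: Order.Disp tt tt. Qed.

(* longer conditions are smaller *)
Definition extends (q p : cond) := prefix p q.

Fact extends_refl : reflexive extends.
Proof. exact: prefix_refl. Qed.

Fact extends_anti : antisymmetric extends.
Proof.
move=> p q /andP[qp pq]; have := pq; rewrite /extends prefixE => /eqP <-.
by rewrite take_oversize // size_prefix.
Qed.

Fact extends_trans : transitive extends.
Proof. by move=> q p r qp rq; exact: prefix_trans rq qp. Qed.

HB.instance Definition _ := Order.Le_isPOrder.Build cond_display cond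
  extends_refl extends_anti extends_trans.

Lemma prefix_nth (b : bool) p q i : prefix p q -> i < size p -> nth b q i = nth b p i.
Proof. by move=> /prefixP[s ->] ip; rewrite nth_cat ip. Qed.

(** The generic point is the union of the filter; the dense sets are indexed by S
    so that only the size of S has to be bounded. *)
Lemma MA_generic_real (I : Type) (S : set I) (D : I -> set (seq bool)) :
  MA_countable ->
  (forall i p, S i -> exists2 q, D i q & prefix p q) ->
  ~ ([set: real] #<= S) ->
  exists z : real, forall i, S i -> exists m, D i (mkseq z m).
Proof.
move=> MA denseD smallS.
have [||||G [[g0 Gg0] _ dirG] GD] := MA _ cond (D @` S).
- by exists [::].
- exact: (countableP (T := seq bool)).
- by move=> _ [i Si <-] p; have [q Dq pq] := denseD i p Si; exists q.
- (* sets of finite binary words are coded by reals *)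
  split; last first.
    by move=> cle; apply: smallS; exact: (card_le_trans cle (card_image_le _ _)).
  pose code (A : set cond) : real := fun n => `[< exists2 p, A p & pickle p = n >].
  apply/pcard_leTP/injPex; exists code => A B _ _ AB; apply/seteqP.
  have sub (A1 B1 : set cond) : code A1 = code B1 -> A1 `<=` B1.
    move=> e p Ap; have : code B1 (pickle p) by rewrite -e; apply/asboolP; exists p.
    by move=> /asboolP[q Bq /(pcan_inj pickleK) <-].
  by split; apply: sub.
pose z n := `[< exists q : cond, [/\ G q, n < size q & nth false q n] >].
have zG (q : cond) n : G q -> n < size q -> nth false q n = z n.
  move=> Gq nq; apply/idP/asboolP => [qn|[p [Gp np pn]]]; first by exists q.
  have [r [_ rp rq]] := dirG _ _ Gp Gq.
  by rewrite -(prefix_nth _ rq nq) (prefix_nth _ rp np).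
exists z => i Si; have [q [Gq Dq]] := GD _ (imageP D Si).
exists (size q); rewrite (_ : mkseq z (size q) = q) //.
apply: (@eq_from_nth _ false); rewrite size_mkseq // => n nq.
by rewrite nth_mkseq // (zG q).
Qed.

(** * A dense independent family and large sets *)

Definition stem (i : nat) : seq bool := odflt [::] (unpickle i).

(** The stem of i makes the family dense.  Beyond the stem, n is read as the code
    of a finite set F of indices together with a counter, and n belongs exactly
    to the members with index in F; the counter makes the family independent. *)
Definition indep (i n : nat) : bool :=
  if n < size (stem i) then nth false (stem i) n
  else if (unpickle n : option (seq nat * nat)) is Some (F, _) then i \in F
  else false.

Lemma indep_dense (p : seq bool) :
  exists i, forall n, n < size p -> indep i n = nth false p n.
Proof. by exists (pickle p) => n np; rewrite /indep /stem pickleK /= np. Qed.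

Lemma indep_independent (S : seq nat) M k :
  exists n, k <= n /\ forall i, i < M -> indep i n = (i \in S).
Proof.
pose B := \max_(i < M) size (stem i).
pose f (t : nat) := pickle (S, t).
have inj_f : injective f by move=> t t' /(pcan_inj pickleK)[].
have [t kt] : exists t, maxn k B <= f t.
  apply: contrapT => /forallNP nt.
  have sub : {subset [seq f t | t <- iota 0 (maxn k B).+1] <= iota 0 (maxn k B)}.
    move=> _ /mapP[t _ ->]; rewrite mem_iota add0n ltnNge; exact/negP/nt.
  have := uniq_leq_size _ sub.
  by rewrite map_inj_uniq ?iota_uniq // size_map !size_iota ltnn => /(_ isT).
exists (f t); split=> [|i iM]; first by apply: leq_trans kt; rewrite leq_maxl.
rewrite /indep ltnNge (leq_trans _ kt) /=; first by rewrite pickleK.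
by apply: leq_trans (leq_maxr _ _); exact: (leq_bigmax (Ordinal iM)).
Qed.

(** The sets w with which the recursion can go on.  Taking M > N shows that only
    finitely many members of the family almost contain w; asking for all M and
    for the members below j as well is what survives the addition of a generic
    difference, and it lets the family itself be added to the final filter. *)
Definition large (w : set nat) := forall j, exists N, forall M k, exists n,
  [/\ k <= n, w n, forall i, i < j -> indep i n & forall i, N <= i < M -> ~~ indep i n].

Lemma large_setT : large setT.
Proof.
move=> j; exists j => M k.
have [n [kn nS]] := indep_independent (iota 0 j) (maxn j M) k.
exists n; split=> // i ij.
  by rewrite nS ?mem_iota //; apply: leq_trans ij _; rewrite leq_maxl.
have /andP[ji iM] := ij; rewrite nS ?mem_iota ?add0n -?leqNgt //.
by apply: leq_trans iM _; rewrite leq_maxr.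
Qed.

(** * Coded maps and generic differences *)

(** The cofinite set with finite initial part s. *)
Definition cofin (s : seq bool) : real := nth true s.

(** The map cofin s |-> indep (h s) is continuous on the cofinite sets and takes
    infinitely many values on each basic open set; the latter is all that is kept
    from the injectivity of a homeomorphism. *)
Definition codes_map (h : seq bool -> nat) :=
  (forall s n, exists m, forall s', (forall i, i < m -> cofin s' i = cofin s i) ->
     indep (h s') n = indep (h s) n) /\
  (forall p N, exists2 s, prefix p s & N <= h s).

(** The values cofin s |-> indep (h s) converge to y as cofin s tends to z. *)
Definition limit_of (h : seq bool -> nat) (z y : real) := forall n, exists m,
  forall s, (forall i, i < m -> cofin s i = z i) -> indep (h s) n = y n.

(** The generic point z meets two kinds of dense sets.  Those of the first kind
    (E) decide the value of the coded map at a given n, so that the limit y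
    exists.  Those of the second kind (D) put into W i and z, and outside y, a
    number n >= k that witnesses largeness for given j and M.  The largeness bound
    N i j of W i remains valid for the smaller set. *)
Lemma large_generic_difference (I : Type) (S : set I) (W : I -> set nat) h :
  MA_countable -> S !=set0 -> (forall i, S i -> large (W i)) ->
  ~ ([set: real] #<= S `*` [set: nat]) -> codes_map h ->
  exists z y : real, limit_of h z y /\
    forall i, S i -> large (W i `&` [set n | z n && ~~ y n]).
Proof.
move=> MA [i0 Si0] largeW smallS [h_cont h_unb].
have /choice[N NP] : forall i, exists N : nat -> nat, S i -> forall j M k, exists n,
    [/\ k <= n, W i n, forall a, a < j -> indep a n &
        forall a, N j <= a < M -> ~~ indep a n].
  move=> i; have [Si|] := pselect (S i); last by exists (fun=> 0).
  by have /choice[N NP] := largeW i Si; exists N.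
pose agree (q s : seq bool) := forall i, i < size q -> cofin s i = cofin q i.
pose E n := [set q | exists b, forall s, agree q s -> indep (h s) n = b].
pose D i (t : nat * nat * nat) := [set q | exists n,
   [/\ t.2 <= n < size q /\ nth false q n, W i n, forall a, a < t.1.1 -> indep a n,
       forall a, N i t.1.1 <= a < t.1.2 -> ~~ indep a n &
       forall s, agree q s -> indep (h s) n = false]].
(* one index set for both kinds of dense sets *)
pose DD (x : I * nat) := match (unpickle x.2 : option (nat + nat * nat * nat)) with
  | Some (inl n) => E n | Some (inr t) => D x.1 t | None => setT end.
have prefix_mk p s m : prefix p s -> size p <= m -> prefix p (mkseq (cofin s) m).
  move=> ps pm; rewrite prefixE; apply/eqP; apply: (@eq_from_nth _ true).
    by rewrite size_takel // size_mkseq.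
  move=> i; rewrite size_takel ?size_mkseq // => ip.
  by rewrite nth_take // nth_mkseq ?(leq_trans ip) //; exact: prefix_nth.
have agree_mk s s' m i : agree (mkseq (cofin s) m) s' -> i < m -> cofin s' i = cofin s i.
  by move=> ag im; rewrite ag ?size_mkseq // /cofin nth_mkseq.
have denseE n p : exists2 q, E n q & prefix p q.
  have [m mP] := h_cont p n.
  exists (mkseq (cofin p) (maxn m (size p))); last first.
    by apply: prefix_mk; rewrite ?prefix_refl ?leq_maxr.
  exists (indep (h p) n) => s ag; apply: mP => i im.
  by apply: agree_mk ag _; apply: leq_trans im _; rewrite leq_maxl.
have denseD i t p : S i -> exists2 q, D i t q & prefix p q.
  move: t => [[j M] k] Si.
  have [s ps Ns] := h_unb p (N i j).
  (* as h s >= N i j, largeness yields such an n outside indep (h s); beyond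
     size s it belongs to cofin s *)
  have [n [kn Wn jn Nn]] := NP i Si j (maxn M (h s).+1) (maxn k (size s)).
  have [m mP] := h_cont s n.
  exists (mkseq (cofin s) (maxn (maxn m n.+1) (size p))); last first.
    by apply: prefix_mk => //; rewrite leq_maxr.
  have nlt : n < maxn (maxn m n.+1) (size p) by rewrite !leq_max ltnS leqnn orbT.
  move: kn; rewrite geq_max => /andP[kn sn].
  exists n; split=> //=.
  - rewrite kn size_mkseq; split=> //.
    by rewrite nth_mkseq // /cofin nth_default.
  - by move=> a /andP[Na aM]; apply: Nn; rewrite Na leq_max aM.
  - move=> s' ag; rewrite mP.
      by apply/negbTE/Nn; rewrite Ns leq_max leqnn orbT.
    by move=> a am; apply: agree_mk ag _; rewrite !leq_max am.
have [||z zP] := MA_generic_real (S := S `*` setT) (D := DD) MA.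
- move=> [i n] p [Si _]; rewrite /DD /=.
  case: unpickle => [[l|t]|]; [exact: denseE|exact: denseD|].
  by exists p; rewrite ?prefix_refl.
- exact: smallS.
have agree_z m s : (forall i, i < m -> cofin s i = z i) -> agree (mkseq z m) s.
  by move=> sz i; rewrite size_mkseq => im; rewrite sz // /cofin nth_mkseq.
have /choice[y yP] : forall n, exists b, exists m, forall s,
    (forall i, i < m -> cofin s i = z i) -> indep (h s) n = b.
  move=> n; have [|m] := zP (i0, pickle (inl n : nat + nat * nat * nat)); first by [].
  rewrite /DD pickleK => -[b bP]; exists b, m => s /agree_z; exact: bP.
exists z, y; split; first by move=> n; have [m mP] := yP n; exists m.
move=> i Si j; exists (N i j) => M k.
have [|m] := zP (i, pickle (inr (j, M, k) : nat + nat * nat * nat)); first by [].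
rewrite /DD pickleK => -[n /= [[/andP[kn nm] zn] Wn jn Nn falsen]].
rewrite size_mkseq in nm; rewrite nth_mkseq // in zn.
exists n; split=> //; split=> //=; rewrite zn /=.
have [m' m'P] := yP n.
(* a cofinite set close enough to z to compute both y n and the forced value *)
pose s := mkseq z (maxn m m').
have sz i' : i' < maxn m m' -> cofin s i' = z i' by move=> ?; rewrite /cofin nth_mkseq.
rewrite -(m'P s); last by move=> i' ?; apply: sz; rewrite leq_max; apply/orP; right.
by rewrite falsen //; apply: agree_z => i' ?; apply: sz; rewrite leq_max; apply/orP; left.
Qed.

(** * The transfinite recursion *)

(** Dependent choice along a well-founded relation: the specification of the value
    at x may look at the values below x only. *)
Lemma well_founded_choice (X : Type) (lt : X -> X -> Prop) (T : pointedType)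
    (Spec : X -> (X -> T) -> T -> Prop) :
  well_founded lt ->
  (forall x g g' a, (forall y, lt y x -> g y = g' y) -> Spec x g a -> Spec x g' a) ->
  (forall x g, exists a, Spec x g a) ->
  exists g, forall x, Spec x g (g x).
Proof.
move=> wf ext ex.
have /choice[F FP] : forall xg : X * (X -> T), exists a, Spec xg.1 xg.2 a.
  by move=> [x g]; exact: ex.
pose extend x (rec : forall y, lt y x -> T) y :=
  if pselect (lt y x) is left yx then rec y yx else point.
pose g := Fix wf (fun=> T) (fun x rec => F (x, extend x rec)).
have gE x : g x = F (x, extend x (fun y _ => g y)).
  rewrite /g Fix_eq // => {}x r r' rr'; congr (F (x, _)); apply/funext => y.
  by rewrite /extend; case: pselect.
exists g => x; apply: (ext x (extend x (fun y _ => g y))) => [y yx|].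
  by rewrite /extend; case: pselect.
by rewrite gE; have := FP (x, extend x (fun y _ => g y)).
Qed.

(** Reads r as the graph of a function. *)
Definition decode (r : real) (s : seq bool) : nat := get [set n : nat | r (pickle (s, n))].

Lemma decode_surj h : exists r, decode r = h.
Proof.
exists (fun k => `[< exists s, pickle (s, h s) = k >]); apply/funext => s.
have : [set n : nat | `[< exists s', pickle (s', h s') = pickle (s, n) >]] (h s).
  by apply/asboolP; exists s.
by move=> /getI/asboolP[s' /(pcan_inj pickleK)[-> ->]].
Qed.

Definition meet (X : eqType) (g : X -> set nat) (l : seq X) :=
  [set n | forall x, x \in l -> g x n].

Definition meets_large (X : eqType) (lt : X -> X -> Prop) (g : X -> set nat) x :=
  forall l, (forall y, y \in l -> lt y x) -> large (meet g l).

Lemma seq_max (X : eqType) (lt : X -> X -> Prop) (l : seq X) :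
  (forall x y z, lt x y -> lt y z -> lt x z) ->
  (forall x y, [\/ lt x y, x = y | lt y x]) ->
  l != [::] ->
  exists2 m, m \in l & forall y, y \in l -> y <> m -> lt y m.
Proof.
move=> lt_trans lt_total; elim: l => [//|x [|x' l] IH] _.
  by exists x; rewrite ?inE // => y; rewrite inE => /eqP.
have [//|m ml mmax] := IH.
have [xm|xm|mx] := lt_total x m.
- exists m; first by rewrite inE ml orbT.
  by move=> y; rewrite inE => /orP[/eqP->//|/mmax].
- exists m; first by rewrite inE ml orbT.
  by move=> y; rewrite inE => /orP[/eqP->//|/mmax].
- exists x; first by rewrite mem_head.
  move=> y; rewrite inE => /orP[/eqP->//|yl] _.
  have [->//|/eqP ym] := eqVneq y m.
  exact: lt_trans (mmax _ yl ym) mx.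
Qed.

(** A finite intersection is handled at its largest index m, where the remaining
    indices lie below m. *)
Lemma large_meet (X : eqType) (lt : X -> X -> Prop) (g : X -> set nat) :
  (forall x y z, lt x y -> lt y z -> lt x z) ->
  (forall x y, [\/ lt x y, x = y | lt y x]) ->
  well_founded lt ->
  (forall x, meets_large lt g x ->
     forall l, (forall y, y \in l -> lt y x) -> large (meet g l `&` g x)) ->
  forall l, large (meet g l).
Proof.
move=> lt_trans lt_total wf large_next.
have aux l : (forall y, y \in l -> meets_large lt g y) -> large (meet g l).
  have [-> _|l0 yl] := eqVneq l [::].
    by rewrite (_ : meet g [::] = setT); [exact: large_setT|apply/seteqP].
  have [m ml mmax] := seq_max lt_trans lt_total l0.
  have := large_next m (yl _ ml) [seq y <- l | y != m].
  rewrite (_ : meet _ _ `&` _ = meet g l).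
    by apply=> y; rewrite mem_filter => /andP[/eqP ym] /mmax; exact.
  apply/seteqP; split=> n /=.
    move=> [nl nm] x xl; have [->//|xm] := eqVneq x m.
    by apply: nl; rewrite mem_filter xm.
  by move=> nl; split=> [x|]; [rewrite mem_filter => /andP[_ /nl]|exact: nl].
have all_large x : meets_large lt g x.
  by elim/(well_founded_ind wf): x => x IH l lx; apply: aux => y /lx; exact: IH.
by move=> l; apply: aux.
Qed.

(** At x the recursion treats the function coded by e x.  The specification is
    conditional on largeness below x, so that it can be met for any earlier
    values; large_meet then discharges the condition. *)
Lemma generic_family : MA_countable ->
  exists (X : eqType) (g : X -> set nat),
    (forall l, large (meet g l)) /\
    forall h, codes_map h -> exists x (u v : real),
      limit_of h u v /\ g x = [set n | u n && ~~ v n].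
Proof.
move=> MA.
have [X [lt [e [wf trans total surj small]]]] := continuum_enumeration.
pose Spec x (g : X -> set nat) a := meets_large lt g x ->
  (codes_map (decode (e x)) -> exists u v : real,
     limit_of (decode (e x)) u v /\ a = [set n | u n && ~~ v n]) /\
  forall l, (forall y, y \in l -> lt y x) -> large (meet g l `&` a).
have meet_ext g g' x l : (forall y, lt y x -> g y = g' y) ->
    (forall y, y \in l -> lt y x) -> meet g l = meet g' l.
  move=> gg' lx; apply/seteqP; split=> n nl y yl; have := nl y yl;
  by rewrite (gg' y (lx y yl)).
have [x g g' a gg'|x g|g gP] := @well_founded_choice X lt (set nat) Spec wf.
- move=> H inv'; have [l lx|t L] := H.
    by rewrite (meet_ext g g' x) //; exact: inv'.
  by split=> // l lx; rewrite -(meet_ext g g' x) //; exact: L.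
- have [inv|] := pselect (meets_large lt g x); last by exists setT.
  have [tk|ntk] := pselect (codes_map (decode (e x))); last first.
    by exists setT => _; split=> // l lx; rewrite setIT; exact: inv.
  have [|u [v [uv L]]] := @large_generic_difference _
    [set l | forall y, y \in l -> lt y x] (meet g) _ MA
    (ex_intro _ [::] _) inv (small x) tk; first by [].
  by exists [set n | u n && ~~ v n] => _; split=> // _; exists u, v.
have L : forall l, large (meet g l).
  by apply: (large_meet trans total wf) => x /gP[].
exists X, g; split=> // h th; have [r rh] := decode_surj h; have [x xr] := surj r.
have [|] := gP x; first by move=> l _; exact: L.
by rewrite xr rh => /(_ th)[u [v uv]] _; exists x, u, v.
Qed.

Lemma generic_ultrafilter : MA_countable ->
  exists U : set_system nat, [/\ UltraFilter U,
    forall s, U [set n | cofin s n],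
    forall i, U [set n | indep i n] &
    forall h, codes_map h -> exists u v : real,
      [/\ limit_of h u v, U [set n | u n] & ~ U [set n | v n]]].
Proof.
move=> /generic_family[X [g [L gP]]].
pose V : set_system nat := [set B | exists l j k, forall n, k <= n -> meet g l n ->
  (forall i, i < j -> indep i n) -> B n].
have VF : ProperFilter V.
  apply: Build_ProperFilter_ex.
    move=> B [l [j [k BP]]]; have [N /(_ 0 k)[n [kn nl jn _]]] := L l j.
    by exists n; exact: BP.
  split.
  - by exists [::], 0, 0.
  - move=> A B [l [j [k AP]]] [l' [j' [k' BP]]].
    exists (l ++ l'), (maxn j j'), (maxn k k') => n.
    rewrite geq_max => /andP[kn k'n] nl nj; split.
      apply: AP => // [x xl|i ij]; first by apply: nl; rewrite mem_cat xl.
      by apply: nj; rewrite leq_max ij.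
    apply: BP => // [x xl|i ij]; first by apply: nl; rewrite mem_cat xl orbT.
    by apply: nj; rewrite leq_max ij orbT.
  - by move=> A B AB [l [j [k AP]]]; exists l, j, k => n *; apply: AB; exact: AP.
have [U [UU VU]] := ultraFilterLemma VF.
exists U; split=> //.
- move=> s; apply: VU; exists [::], 0, (size s) => n sn _ _ /=.
  by rewrite /cofin nth_default.
- by move=> i; apply: VU; exists [::], i.+1, 0 => n _ _; exact.
move=> h /gP[x [u [v [uv gx]]]].
have Ugx : U (g x) by apply: VU; exists [:: x], 0, 0 => n _ /(_ x (mem_head _ _)).
rewrite gx in Ugx.
exists u, v; split=> //.
  by apply: filterS Ugx => n /= /andP[].
have UF : ProperFilter U := @ultra_proper _ _ UU.
move=> Uv; have /filter_ex[n [/= /andP[_ /negP nv vn]]] :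
    U ([set n | u n && ~~ v n] `&` [set n | v n]) by exact: filterI.
exact: nv.
Qed.

(** * Topology of the ultrafilter *)

(** The filter generated by the cylinders at x converges to x. *)
Lemma cantor_cylinder (x : cantor_space) (O : set cantor_space) :
  nbhs x O -> exists m, forall x' : cantor_space, (forall i, i < m -> x' i = x i) -> O x'.
Proof.
pose cyl m := [set x' : cantor_space | forall i, i < m -> x' i = x i].
pose F := filter_from [set: nat] cyl.
have FF : Filter F.
  apply: filter_from_filter; first by exists 0.
  move=> m n _ _; exists (maxn m n) => // x' xx'; split=> i ilt; apply: xx';
  by rewrite leq_max ilt ?orbT.
suff Fx : F --> x by move=> /Fx[m _ mO]; exists m.
apply/cvg_sup => i A [B [[C oC <-] Cx BA]]; exists i.+1 => // x' xx'.
by apply: BA; rewrite /= xx'.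
Qed.

Lemma cantor_open_coord n (b : bool) : open [set x : cantor_space | x n = b].
Proof.
apply: (@continuousP cantor_space bool (fun x => x n)).1 (discrete_open [set b]) => x.
exact: (@proj_continuous nat (fun=> bool) n x).
Qed.

(** A homeomorphism f that maps the cofinite sets onto the independent family has
    a code h.  Since cofinite sets converge to u inside U, continuity gives
    f u = v, although v is not in U. *)
Lemma not_countable_dense_homogeneous (U : set_system nat) :
  UltraFilter U ->
  (forall s, U [set n | cofin s n]) ->
  (forall i, U [set n | indep i n]) ->
  (forall h, codes_map h -> exists u v : real,
      [/\ limit_of h u v, U [set n | u n] & ~ U [set n | v n]]) ->
  ~ countable_dense_homogeneous (set_type (cantor_set_of U)).
Proof.
move=> UU Ucof Uind kill cdh.
pose XU : Type := set_type (cantor_set_of U).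
have mkU (r : real) : U [set n | r n] -> exists x : XU, val x = r.
  by move=> Ur; exists (exist _ (r : cantor_space) (mem_set Ur)).
have /choice[c cE] : forall s, exists x : XU, val x = cofin s.
  by move=> s; exact: mkU.
have /choice[d dE] : forall i, exists x : XU, val x = indep i.
  by move=> i; exact: mkU.
have valU (x : XU) : U [set n | val x n] by have := set_valP x.
have nbhsU (x : XU) (O : set XU) : open O -> O x -> exists m, forall x' : XU,
    (forall i, i < m -> val x' i = val x i) -> O x'.
  move=> [O' oO' <-] Ox; have [|m mP] := @cantor_cylinder (val x) O'.
    by apply: open_nbhs_nbhs; split.
  by exists m => x' xx'; apply: mP.
have coordU n b : open [set x : XU | val x n = b].
  by exists [set x : cantor_space | x n = b]; first exact: cantor_open_coord.
have dense_rangeE (I : Type) (a : I -> XU) :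
    (forall p : seq bool, exists i, forall n, n < size p ->
       val (a i) n = nth false p n) -> dense (range a).
  move=> ap O [x Ox] oO; have [m mP] := nbhsU x O oO Ox.
  have [i ip] := ap (mkseq (val x) m); exists (a i); split; last by exists i.
  by apply: mP => j jm; rewrite ip ?size_mkseq // nth_mkseq.
have ctbl (I : countType) (a : I -> XU) : countable (range a).
  by apply: sub_countable (card_image_le _ _) _; exact: countableP.
have dense_c : dense (range c).
  apply: dense_rangeE => p; exists p => n np.
  by rewrite cE /cofin; apply: set_nth_default.
have dense_d : dense (range d).
  apply: dense_rangeE => p; have [i ip] := indep_dense p.
  by exists i => n np; rewrite dE ip.
have [f [cont_f [g [_ fK _]]] fE] :=
  cdh (range c) (range d) (ctbl _ c) dense_c (ctbl _ d) dense_d.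
have cont_coord (x : XU) n : exists m, forall x' : XU,
    (forall i, i < m -> val x' i = val x i) -> val (f x') n = val (f x) n.
  apply: (nbhsU x [set x' | val (f x') n = val (f x) n]) => //.
  exact: (continuousP _).1 cont_f _ (coordU _ _).
have /choice[h hP] : forall s, exists i, f (c s) = d i.
  move=> s; have [i _ <-] : range d (f (c s)); last by exists i.
  by rewrite -fE; exists (c s) => //; exists s.
have hE s n : indep (h s) n = val (f (c s)) n by rewrite hP dE.
have th : codes_map h.
  split=> [s n|p N].
    have [m mP] := cont_coord (c s) n; exists m => s' ss'.
    by rewrite !hE; apply: mP => i im; rewrite !cE; exact: ss'.
  (* distinct m give distinct cofinite sets, hence distinct indices, in the basic
     open set of p *)
  pose s m := p ++ rcons (nseq m true) false.
  have inj_hs : injective (h \o s).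
    move=> m m' /= e.
    have : c (s m) = c (s m') by rewrite -(fK (c (s m))) hP e -hP fK.
    wlog mm' : m m' e / m < m'.
      move=> W; have [mm'|mm'|//] := ltngtP m m'; first exact: W.
      by move/esym/(W _ _ (esym e) mm').
    move=> /(congr1 val); rewrite !cE => /(congr1 (fun r => r (size p + m))).
    rewrite /cofin /s !nth_cat !ltnNge leq_addr /= addKn !nth_rcons !size_nseq.
    rewrite ltnn eqxx mm'.
    by rewrite nth_nseq mm'.
  apply: contrapT => nN.
  have sub : {subset [seq h (s m) | m <- iota 0 N.+1] <= iota 0 N}.
    move=> _ /mapP[m _ ->]; rewrite mem_iota add0n ltnNge; apply/negP => Nh.
    by apply: nN; exists (s m); rewrite ?prefix_prefix.
  have := uniq_leq_size _ sub; rewrite (map_inj_uniq inj_hs) ?iota_uniq //.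
  by rewrite size_map !size_iota ltnn => /(_ isT).
have [u [v [uv Uu nUv]]] := kill h th.
apply: nUv; have [x xu] := mkU u Uu.
suff -> : v = val (f x) by exact: valU.
apply/funext => n; have [m mP] := cont_coord x n; have [m' m'P] := uv n.
(* a cofinite set close enough to u to compute both f x and v at n *)
pose s := mkseq u (maxn m m').
have su i : i < maxn m m' -> cofin s i = u i by move=> ?; rewrite /cofin nth_mkseq.
rewrite -(mP (c s)) => [|i im]; last by rewrite cE xu su // leq_max im.
by rewrite -hE m'P // => i im; rewrite su // leq_max im orbT.
Qed.

Theorem theorem15 :
  MA_countable ->
  exists U : set_system nat,
    UltraFilter U /\
    ~ countable_dense_homogeneous (set_type (cantor_set_of U)).
Proof.
move=> /generic_ultrafilter[U [UU Ucof Uind kill]].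
by exists U; split=> //; exact: not_countable_dense_homogeneous.
Qed.
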